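(* Let the Lagrange multipliers $\boldsymbol{\eta}=\{\eta_n\}_{n=1}^N$, $\eta_n\ge0$, be given. The control policy obtained by solving the reduced-state Bellman equation $$\theta+V(\mathbf{Q},\mathbf{B})=\min_{\Omega(\mathbf{Q},\mathbf{B})}\Big\{g(\mathbf{Q},\mathbf{B},\Omega(\mathbf{Q},\mathbf{B}))+\sum_{\mathbf{Q}',\mathbf{B}'}\Pr[\mathbf{Q}'|\mathbf{Q},\mathbf{B},\Omega(\mathbf{Q},\mathbf{B})]\,\Pr[\mathbf{B}'|\mathbf{B},\Omega(\mathbf{Q},\mathbf{B})]\,V(\mathbf{Q}',\mathbf{B}')\Big\},\quad\forall\,\mathbf{Q}\in\mathcal{Q},\ \mathbf{B}\in\mathcal{B},$$ is equivalent to the control policy obtained by solving the post-decision Bellman equation $$\theta+V(\widetilde{\mathbf{Q}},\widetilde{\mathbf{B}})=\sum_{\mathbf{Q},\mathbf{B}}\Pr[\mathbf{Q}|\widetilde{\mathbf{Q}},\widetilde{\mathbf{B}}]\,\Pr[\mathbf{B}|\widetilde{\mathbf{B}}]\min_{\Omega(\mathbf{Q},\mathbf{B})}\Big\{g(\mathbf{Q},\mathbf{B},\Omega(\mathbf{Q},\mathbf{B}))+\sum_{\widetilde{\mathbf{Q}}',\widetilde{\mathbf{B}}'}\Pr[\widetilde{\mathbf{Q}}'|\mathbf{Q},\Omega(\mathbf{Q},\mathbf{B})]\,\Pr[\widetilde{\mathbf{B}}'|\mathbf{B},\Omega(\mathbf{Q},\mathbf{B})]\,V(\widetilde{\mathbf{Q}}',\widetilde{\mathbf{B}}')\Big\},$$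 for all $\widetilde{\mathbf{Q}}\in\mathcal{Q}$, $\widetilde{\mathbf{B}}\in\mathcal{B}$, where $$V(\widetilde{\mathbf{Q}},\widetilde{\mathbf{B}})=\mathbf{E}_{\mathbf{Q}|\widetilde{\mathbf{Q}},\,\mathbf{B}|\widetilde{\mathbf{B}}}[V(\mathbf{Q},\mathbf{B})]$$ is the expectation taken over all the pre-decision reduced states $(\mathbf{Q},\mathbf{B})$ that can be reached from the post-decision reduced state $(\widetilde{\mathbf{Q}},\widetilde{\mathbf{B}})$.
   Context: System with $N$ energy-harvesting sensor nodes in slotted time. The global state is $\mathbf{S}=(\mathbf{H},\mathbf{Q},\mathbf{B})\in\mathcal{S}=\mathcal{H}\times\mathcal{Q}\times\mathcal{B}$, taking discrete bounded values: $\mathbf{H}=\{H_n\}$ channel gains (CSI), $\mathbf{Q}=\{Q_n\}$, $Q_n\in\{0,\dots,Q_{\max}\}$, data queue lengths, $\mathbf{B}=\{B_n\}$, $B_n\in\{0,\dots,B_{\max}\}$, battery levels. The action is $\mathbf{a}=(\mathbf{x},\mathbf{p}^{\mathrm T})$ in a discrete finite action space $\mathcal{A}$, with $x_n\in\{0,1\}$, $\sum_nx_n\le1$, $0\le p_n^{\mathrm T}\le B_n$, $x_n=\mathbf{I}\{p_n^{\mathrm T}>0\}$. A (stationary deterministic Markovian) control policy is a map $\Omega:\mathcal{S}\to\mathcal{A}$; $\Omega(\mathbf{Q},\mathbf{B})=\{\Omega(\mathbf{H},\mathbf{Q},\mathbf{B})\,|\,\forall\mathbf{H}\}$ is the collection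 of $|\mathcal{H}|$ actions, one for each CSI realization $\mathbf{H}\in\mathcal{H}$, that $\Omega$ assigns to the states with the given $(\mathbf{Q},\mathbf{B})$. Reduced states (operations componentwise in $n$): the pre-decision reduced state is $(\mathbf{Q},\mathbf{B})$ at the beginning of a slot. With CSI $\mathbf{H}$ and transmission energies $\mathbf{p}^{\mathrm T}$, the post-decision reduced state, immediately after the action but before new harvested energy and newly sensed data arrive, is $$(\widetilde{\mathbf{Q}}',\widetilde{\mathbf{B}}')=(\max[0,\mathbf{Q}-\mathbf{r}(\mathbf{H},\mathbf{p}^{\mathrm T})],\ \mathbf{B}-\mathbf{p}^{\mathrm T}),$$ where $r(H_n,p)=\frac{\tau W}{K}\log_2\big(1+\xi_n\frac{H_np}{N_0W\tau}\big)$ with positive constants $\tau,W,K,\xi_n,N_0$. The pre-decision reduced state reached from a post-decision reduced state $(\widetilde{\mathbf{Q}},\widetilde{\mathbf{B}})$ of the previous slot is $$(\mathbf{Q},\mathbf{B})=\big(\min[Q_{\max}\mathbf{e},\widetilde{\mathbf{Q}}+\min[\mathbf{A},\gamma\widetilde{\mathbf{B}}]],\ \min[B_{\max}\mathbf{e},\max[0,\widetilde{\mathbf{B}}-\mathbf{A}/\gamma]+\mathbf{E}]\big),$$ where $\mathbf{e}$ is the all-ones vector, $\gamma$ is a positive constant, and $\mathbf{A}=\{A_n\}$ (packet arrivals), $\mathbf{E}=\{E_n\}$ (harvested energy) during that slot are i.i.d. over slots and independent over $n$. $\Pr[\mathbf{Q}|\widetilde{\mathbf{Q}},\widetilde{\mathbf{B}}]$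 and $\Pr[\mathbf{B}|\widetilde{\mathbf{B}}]$ are the transition probabilities of the two components of this last map; the transition probability of the pair is taken to be their product. State transitions: each channel $H_n$ is a first-order finite-state Markov chain, and $\Pr[\mathbf{S}'|\mathbf{S},\mathbf{a}]=\Pr[\mathbf{H}'|\mathbf{H}]\Pr[\mathbf{Q}'|\mathbf{H},\mathbf{Q},\mathbf{B},\mathbf{a}]\Pr[\mathbf{B}'|\mathbf{B},\mathbf{a}]$, the last two factors being derived from the queue and battery dynamics above. Quantities conditioned on $\Omega(\mathbf{Q},\mathbf{B})$ are conditional expectations over the CSI, with $\Pr[\mathbf{H}]$ the probability of $\mathbf{H}$, for given $(\mathbf{Q},\mathbf{B})$: $g(\mathbf{Q},\mathbf{B},\Omega(\mathbf{Q},\mathbf{B}))=\mathbf{E}_{\mathbf{H}}[g(\mathbf{S},\Omega(\mathbf{S}))|\mathbf{Q},\mathbf{B}]$, $\Pr[\mathbf{Q}'|\mathbf{Q},\mathbf{B},\Omega(\mathbf{Q},\mathbf{B})]=\mathbf{E}_{\mathbf{H}}[\Pr[\mathbf{Q}'|\mathbf{H},\mathbf{Q},\mathbf{B},\Omega(\mathbf{S})]|\mathbf{Q},\mathbf{B}]$, $\Pr[\mathbf{B}'|\mathbf{B},\Omega(\mathbf{Q},\mathbf{B})]=\mathbf{E}_{\mathbf{H}}[\Pr[\mathbf{B}'|\mathbf{B},\Omega(\mathbf{S})]|\mathbf{Q},\mathbf{B}]$, and similarly for $\Pr[\widetilde{\mathbf{Q}}'|\mathbf{Q},\Omega(\mathbf{Q},\mathbf{B})]$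 and $\Pr[\widetilde{\mathbf{B}}'|\mathbf{B},\Omega(\mathbf{Q},\mathbf{B})]$. The per-stage reward function (to be minimized) is $$g(\mathbf{S},\Omega(\mathbf{S}))=\sum_{n=1}^N\omega_n+\sum_{n=1}^N\eta_nQ_n-\sum_{n=1}^N\Big[\frac{\omega_n}{\lambda_n}+\eta_nD_{\max}\Big]\min[Q_n,r(H_n,p_n^{\mathrm T})],$$ with given weights $\omega_n$, mean arrival rates $\lambda_n=\mathbf{E}[A_n]$, and a constant $D_{\max}$ (maximum tolerable average delay). $V$ denotes the value functions and $\theta$ is the optimal average reward per period in steady state.
   Formalization: In both equations the expectation over the CSI is taken of the product of the queue and battery transition probabilities, not of each factor separately (with separate averages the claim fails); the queue and battery dynamics are assumed to stay on the integer grid. *)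

(* Defs.v *)
From HB Require Import structures.
From mathcomp Require Import all_boot all_order all_algebra.
From mathcomp Require Import finmap.
From mathcomp Require Import all_classical all_reals all_analysis.

Set Implicit Arguments.
Unset Strict Implicit.
Unset Printing Implicit Defensive.

Import Order.TTheory GRing.Theory Num.Theory.

Local Open Scope ring_scope.

Notation queue N Qmax := {ffun 'I_N -> 'I_Qmax.+1}.
Notation battery N Bmax := {ffun 'I_N -> 'I_Bmax.+1}.

(* (x, pT): scheduling indicators and transmission energies. *)
Notation action N Bmax :=
  ({ffun 'I_N -> bool} * {ffun 'I_N -> 'I_Bmax.+1})%type.

(* A local CSI state is a gain value from the finite set [chan n]. *)
Notation csi_of chan := {dffun forall n, chan n}.

Definition idle {N Bmax : nat} : action N Bmax :=
  ([ffun=> false], [ffun=> ord0]).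

(* The index set is finite and [F n] may be [setT], so the product rule for the
   whole family contains the one for every subfamily. *)
Definition mutually_independent d (T : measurableType d) (R : realType)
    (P : probability T R) (N : nat) (X : 'I_N -> T -> R) : Prop :=
  forall F : 'I_N -> set R, (forall n, measurable (F n)) ->
    P [set w | forall n, F n (X n w)]%classic
      = (\prod_(n < N) fine (P (X n @^-1` F n)%classic))%:E.

(* [ln _ / ln 2] is the base-2 logarithm. *)
Definition rate {R : realType} (tau W K N0 xi h p : R) : R :=
  tau * W / K * (ln (1 + xi * (h * p / (N0 * W * tau))) / ln 2).

Definition post_queue {R : realType} (q r : R) : R := Num.max 0 (q - r).
Definition post_battery {R : realType} (b p : R) : R := b - p.
Definition pre_queue {R : realType} (Qmax : nat) (gamma qt bt A : R) : R :=
  Num.min Qmax%:R (qt + Num.min A (gamma * bt)).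
Definition pre_battery {R : realType} (Bmax : nat) (gamma bt A E : R) : R :=
  Num.min Bmax%:R (Num.max 0 (bt - A / gamma) + E).

Definition feasible {N Bmax : nat} (actions : {set action N Bmax})
    (B : battery N Bmax) (a : action N Bmax) : bool :=
  [&& a \in actions,
      (\sum_(n < N) (a.1 n : nat) <= 1)%N
    & [forall n, (a.2 n <= B n)%N && (a.1 n == (0 < a.2 n)%N)]].

(* [arr] and [harv] are the arrivals and the harvested energy of a generic slot;
   "i.i.d. over slots" means that this one law drives every transition. *)
Record system (R : realType) (d : measure_display) (T : measurableType d)
    (P : probability T R) (N Qmax Bmax : nat) := System {
  tau : R; bandwidth : R; pkt_len : R; N0 : R; xi : 'I_N -> R; gamma : R;
  tau_gt0 : 0 < tau; bandwidth_gt0 : 0 < bandwidth; pkt_len_gt0 : 0 < pkt_len; N0_gt0 : 0 < N0;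
  xi_gt0 : forall n, 0 < xi n; gamma_gt0 : 0 < gamma;
  omega : 'I_N -> R;
  Dmax : R;

  chan : 'I_N -> {fset R};
  chan_ge0 : forall n (h : chan n), 0 <= val h;
  (* enters the law of the full state (H, Q, B), but not the reduced-state
     equations, which average over the CSI law [csi_prob] *)
  chan_trans : forall n, chan n -> chan n -> R;
  chan_trans_ge0 : forall n h h', 0 <= @chan_trans n h h';
  chan_trans_sum1 : forall n h, \sum_h' @chan_trans n h h' = 1;
  csi_prob : csi_of chan -> R;
  csi_prob_ge0 : forall H, 0 <= csi_prob H;
  csi_prob_sum1 : \sum_H csi_prob H = 1;

  actions : {set action N Bmax};
  idle_action : idle \in actions;

  arr : 'I_N -> {RV P >-> R};
  harv : 'I_N -> {RV P >-> R};
  arr_ge0 : forall n w, 0 <= arr n w;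
  harv_ge0 : forall n w, 0 <= harv n w;
  arr_indep : mutually_independent P (fun n => arr n : T -> R);
  harv_indep : mutually_independent P (fun n => harv n : T -> R);
  arr_integrable : forall n, P.-integrable setT (EFin \o arr n);
  arr_mean_gt0 : forall n, (0 < 'E_P[arr n])%E;

  (* The dynamics are real-valued formulas, while queues and batteries take the
     values 0..Qmax and 0..Bmax: the data are such that the dynamics stay
     there. The bounds themselves follow from the formulas. *)
  post_queue_nat : forall (H : csi_of chan) (Q : queue N Qmax)
      (B : battery N Bmax) a, feasible actions B a -> forall n,
    post_queue (Q n)%:R (rate tau bandwidth pkt_len N0 (xi n) (val (H n)) (a.2 n)%:R)
      \is a Num.nat;
  pre_queue_nat : forall (Q : queue N Qmax) (B : battery N Bmax),
    {ae P, forall w, forall n,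
      pre_queue Qmax gamma (Q n)%:R (B n)%:R (arr n w) \is a Num.nat};
  pre_battery_nat : forall B : battery N Bmax,
    {ae P, forall w, forall n,
      pre_battery Bmax gamma (B n)%:R (arr n w) (harv n w) \is a Num.nat}
}.

Section ReducedState.
Context {R : realType} {d : measure_display} {T : measurableType d}.
Context {P : probability T R} {N Qmax Bmax : nat}.
Variable M : system P N Qmax Bmax.

Let Qst := queue N Qmax.
Let Bst := battery N Bmax.
Let act := action N Bmax.

Definition csi := csi_of (chan M).

(* Omega(Q, B): one action for each CSI realization *)
Definition collection := {ffun csi -> act}.

Definition policy := csi * Qst * Bst -> act.

Definition admissible (Om : policy) : Prop :=
  forall H Q B, feasible (actions M) B (Om (H, Q, B)).

Definition at_reduced (Om : policy) (Q : Qst) (B : Bst) : collection :=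
  [ffun H => Om (H, Q, B)].

Definition admissible_collection (B : Bst) (u : collection) : bool :=
  [forall H, feasible (actions M) B (u H)].

Definition mean_arr (n : 'I_N) : R := fine 'E_P[arr M n].

Definition served (H : csi) (a : act) (n : 'I_N) : R :=
  rate (tau M) (bandwidth M) (pkt_len M) (N0 M) (xi M n) (val (H n)) (a.2 n)%:R.

Definition stage_reward (eta : 'I_N -> R) (H : csi) (Q : Qst) (a : act) : R :=
  \sum_(n < N) omega M n + \sum_(n < N) eta n * (Q n)%:R
  - \sum_(n < N) (omega M n / mean_arr n + eta n * Dmax M)
                 * Num.min (Q n)%:R (served H a n).

Definition Ecsi (f : csi -> R) : R := \sum_H csi_prob H * f H.

Definition postQ (H : csi) (Q : Qst) (a : act) (n : 'I_N) : R :=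
  post_queue (Q n)%:R (served H a n).
Definition postB (B : Bst) (a : act) (n : 'I_N) : R :=
  post_battery (B n)%:R (a.2 n)%:R.

(* Pr[Q | Qt, Bt] and Pr[B | Bt] *)
Definition prQ (qt bt : 'I_N -> R) (Q : Qst) : R :=
  fine (P [set w | forall n,
    (Q n)%:R = pre_queue Qmax (gamma M) (qt n) (bt n) (arr M n w)]%classic).
Definition prB (bt : 'I_N -> R) (B : Bst) : R :=
  fine (P [set w | forall n,
    (B n)%:R = pre_battery Bmax (gamma M) (bt n) (arr M n w) (harv M n w)]
    %classic).

(* Pr[Q' | H, Q, B, a] and Pr[B' | B, a] *)
Definition trQ (H : csi) (Q : Qst) (B : Bst) (a : act) (Q' : Qst) : R :=
  prQ (postQ H Q a) (postB B a) Q'.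
Definition trB (B : Bst) (a : act) (B' : Bst) : R := prB (postB B a) B'.

(* Pr[Qt' | H, Q, a] and Pr[Bt' | B, a]: point masses *)
Definition trQt (H : csi) (Q : Qst) (a : act) (Qt' : Qst) : R :=
  [forall n, (Qt' n)%:R == postQ H Q a n]%:R.
Definition trBt (B : Bst) (a : act) (Bt' : Bst) : R :=
  [forall n, (Bt' n)%:R == postB B a n]%:R.

(* Queue and battery transitions factorize given the CSI, and the conditional
   expectation over the CSI is taken of the product: both factors are driven by
   the same transmission energies, so the product of the two averages would not
   be the law of the next reduced state. *)
Definition reduced_objective (eta : 'I_N -> R) (V : Qst -> Bst -> R)
    (Q : Qst) (B : Bst) (u : collection) : R :=
  Ecsi (fun H => stage_reward eta H Q (u H))
  + \sum_(Q' : Qst) \sum_(B' : Bst)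
      Ecsi (fun H => trQ H Q B (u H) Q' * trB B (u H) B') * V Q' B'.

Definition post_objective (eta : 'I_N -> R) (Vt : Qst -> Bst -> R)
    (Q : Qst) (B : Bst) (u : collection) : R :=
  Ecsi (fun H => stage_reward eta H Q (u H))
  + \sum_(Qt' : Qst) \sum_(Bt' : Bst)
      Ecsi (fun H => trQt H Q (u H) Qt' * trBt B (u H) Bt') * Vt Qt' Bt'.

(* The idle collection is admissible, so as default value of the iterated
   minimum it does not affect the result. *)
Definition min_collection (B : Bst) (F : collection -> R) : R :=
  \big[Num.min/F [ffun=> idle]]_(u | admissible_collection B u) F u.

(* Expectation over the pre-decision states reached from (Qt, Bt) *)
Definition Epre (Qt : Qst) (Bt : Bst) (f : Qst -> Bst -> R) : R :=
  \sum_(Q : Qst) \sum_(B : Bst)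
    prQ (fun n => (Qt n)%:R) (fun n => (Bt n)%:R) Q
    * prB (fun n => (Bt n)%:R) B * f Q B.

Definition post_value (V : Qst -> Bst -> R) (Qt : Qst) (Bt : Bst) : R :=
  Epre Qt Bt V.

Definition reduced_bellman (eta : 'I_N -> R) (theta : R) (V : Qst -> Bst -> R)
    : Prop :=
  forall Q B, theta + V Q B = min_collection B (reduced_objective eta V Q B).

Definition post_bellman (eta : 'I_N -> R) (theta : R) (Vt : Qst -> Bst -> R)
    : Prop :=
  forall Qt Bt, theta + Vt Qt Bt =
    Epre Qt Bt (fun Q B => min_collection B (post_objective eta Vt Q B)).

Definition attains (obj : Qst -> Bst -> collection -> R) (Om : policy) : Prop :=
  admissible Om /\
  forall Q B, obj Q B (at_reduced Om Q B) = min_collection B (obj Q B).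

Definition reduced_policy (eta : 'I_N -> R) (Om : policy) : Prop :=
  exists theta V,
    reduced_bellman eta theta V /\ attains (reduced_objective eta V) Om.

Definition post_policy (eta : 'I_N -> R) (Om : policy) : Prop :=
  exists theta Vt,
    post_bellman eta theta Vt /\ attains (post_objective eta Vt) Om.

End ReducedState.

(* Main.v *)
Require Import Defs.
From HB Require Import structures.
From mathcomp Require Import all_boot all_order all_algebra.
From mathcomp Require Import all_classical all_reals all_analysis.
From mathcomp Require Import measurable_realfun.

Set Implicit Arguments.
Unset Strict Implicit.
Unset Printing Implicit Defensive.

Import Order.TTheory GRing.Theory Num.Theory.

Local Open Scope ring_scope.

(* Given the CSI, the slot's transition factors through the post-decision state,
   which is a deterministic function of the action. Hence the reduced objective
   for V equals the post-decision objective for the average of V over the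
   pre-decision states reached, and the two minimisations coincide. Averaging
   one Bellman equation gives the other because the arrival and harvest
   transition probabilities sum to one; conversely V is recovered from the
   post-decision value as the minimised post-decision objective minus theta. *)

Section FiniteLaw.
Context {R : realType} {d : measure_display} {T : measurableType d}.
Variable P : probability T R.

(** The union has a negligible complement, hence probability one, and disjointness splits it into
    the sum. Almost sure covering is enough, which matters because the dynamics are integer-valued
    only almost surely. *)
Lemma sum_probability_partition (I : finType) (F : I -> set T) :
  (forall i, measurable (F i)) -> trivIset setT F ->
  {ae P, forall w, exists i, F i w} -> \sum_i fine (P (F i)) = 1.
Proof.
move=> mF tF [B [mB PB0 FB]].
set U := (\bigcup_(i in [set` index_enum I]) F i)%classic.
have mU : measurable U by apply: fin_bigcup_measurable.
have UB : (~` U `<=` B)%classic.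
  move=> w nUw; apply: FB => -[i Fiw].
  by apply: nUw; exists i => //=; rewrite mem_index_enum.
have PU1 : P U = 1%E.
  rewrite -[U]setCK probability_setC; last exact: measurableC.
  by rewrite (subset_measure0 _ _ UB PB0) ?sube0 //; apply: measurableC.
rewrite sum_fine; last by move=> i _; apply: fin_num_measure.
have -> : (\sum_i P (F i) = P U)%E; last by rewrite PU1.
rewrite measure_fin_bigcup //; last exact: sub_trivIset tF.
by rewrite -fsbig_seq // index_enum_uniq.
Qed.

(** Bridge from the real-valued dynamics to the finite state space, used both for random
    pre-decision states and for deterministic post-decision ones. *)
Lemma exists_natr_ffun {N K : nat} (f : 'I_N -> R) :
  (forall n, f n \is a Num.nat) -> (forall n, f n <= K%:R) ->
  exists X : {ffun 'I_N -> 'I_K.+1}, forall n, (X n)%:R = f n.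
Proof.
move=> fnat fK; exists [ffun n => inord (Num.truncn (f n))] => n.
have fE : (Num.truncn (f n))%:R = f n by apply/eqP; rewrite -natrEtruncn.
by rewrite ffunE inordK // ltnS -(ler_nat R) fE.
Qed.

Lemma sum_probability_ffun (N K : nat) (X : 'I_N -> T -> R) :
  (forall n, measurable_fun setT (X n)) ->
  {ae P, forall w, forall n, X n w \is a Num.nat} ->
  (forall n w, X n w <= K%:R) ->
  \sum_(k : {ffun 'I_N -> 'I_K.+1})
    fine (P [set w | forall n, (k n)%:R = X n w]%classic) = 1.
Proof.
move=> mX Xnat XK; apply: sum_probability_partition.
- move=> k.
  have -> : [set w | forall n, (k n)%:R = X n w]%classic
      = (\bigcap_(n in setT) (X n @^-1` [set (k n)%:R]))%classic.
    by apply/seteqP; split=> w /= kX n => [_|]; [rewrite /= kX | rewrite [RHS]kX].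
  apply: fin_bigcap_measurable => // n _.
  by rewrite -[X in measurable X]setTI; apply: mX.
(* Disjointness: naturals embed injectively into [R], so one outcome [w] determines the state. *)
- move=> k l _ _ [w [/= kX lX]]; apply/ffunP => n; apply/val_inj/eqP.
  by rewrite -(eqr_nat R) kX lX.
- apply: filterS Xnat => w Xw.
  by have [k kX] := exists_natr_ffun Xw (XK^~ w); exists k.
Qed.

End FiniteLaw.

Section PostDecision.
Context {R : realType} {d : measure_display} {T : measurableType d}.
Context {P : probability T R} {N Qmax Bmax : nat}.
Variable M : system P N Qmax Bmax.

Implicit Types (Q Qt : queue N Qmax) (B Bt : battery N Bmax).
Implicit Types (V f : queue N Qmax -> battery N Bmax -> R) (theta : R).

Lemma sum_prQ Qt Bt :
  \sum_Q prQ M (fun n => (Qt n)%:R) (fun n => (Bt n)%:R) Q = 1.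
Proof.
apply: sum_probability_ffun.
- move=> n; apply: measurable_minr; first exact: measurable_cst.
  apply: measurable_funD; first exact: measurable_cst.
  by apply: measurable_minr; last exact: measurable_cst.
- exact: pre_queue_nat.
- by move=> n w; rewrite ge_min lexx.
Qed.

Lemma sum_prB Bt : \sum_B prB M (fun n => (Bt n)%:R) B = 1.
Proof.
apply: sum_probability_ffun.
- move=> n; apply: measurable_minr; first exact: measurable_cst.
  apply: measurable_funD => //.
  apply: measurable_maxr; first exact: measurable_cst.
  apply: measurable_funB; first exact: measurable_cst.
  by apply: measurable_funM; last exact: measurable_cst.
- exact: pre_battery_nat.
- by move=> n w; rewrite ge_min lexx.
Qed.

(** The weights have total mass one: summing out [B] first is possible because its law depends on
    [Bt] alone. *)
Lemma EpreDl Qt Bt theta f :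
  Epre M Qt Bt (fun Q B => theta + f Q B) = theta + Epre M Qt Bt f.
Proof.
rewrite /Epre; under eq_bigr => Q _ do
  (under eq_bigr => B _ do rewrite mulrDr; rewrite big_split /=).
rewrite big_split /=; congr (_ + _).
under eq_bigr => Q _ do rewrite -mulr_suml -mulr_sumr sum_prB mulr1.
by rewrite -mulr_suml sum_prQ mul1r.
Qed.

Lemma eq_Epre Qt Bt f g : f =2 g -> Epre M Qt Bt f = Epre M Qt Bt g.
Proof. by move=> fg; do 2!apply: eq_bigr => ? _; rewrite fg. Qed.

Lemma served_ge0 (H : csi M) a n : 0 <= served H a n.
Proof.
have tau0 := ltW (tau_gt0 M); have W0 := ltW (bandwidth_gt0 M).
have K0 := ltW (pkt_len_gt0 M); have N00 := ltW (N0_gt0 M).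
have xi0 := ltW (xi_gt0 M n); have h0 := chan_ge0 (H n).
rewrite /served /rate !mulr_ge0 ?invr_ge0 ?ln_ge0 ?ler1n //.
by rewrite lerDl !mulr_ge0 ?invr_ge0 ?mulr_ge0.
Qed.

Lemma postQ_le (H : csi M) Q a n : postQ H Q a n <= Qmax%:R.
Proof.
rewrite /postQ /post_queue ge_max ler0n /=.
apply: (@le_trans _ _ (Q n)%:R); first by rewrite gerBl served_ge0.
by rewrite ler_nat -ltnS.
Qed.

(** Feasibility bounds the energy spent by the battery level, so the real subtraction is a natural
    one; it also gives access to the integrality assumption on queues. *)
Lemma post_state (H : csi M) Q B a : feasible (actions M) B a ->
  exists Qt Bt, (forall n, (Qt n)%:R = postQ H Q a n)
    /\ (forall n, (Bt n)%:R = postB B a n :> R).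
Proof.
move=> feas.
have [Qt QtE] :=
  exists_natr_ffun (post_queue_nat H Q feas) (postQ_le H Q a).
case/and3P: feas => _ _ /forallP aB.
have [Bt BtE] : exists Bt : battery N Bmax,
    forall n, (Bt n)%:R = postB B a n :> R.
  apply: exists_natr_ffun => n; have /andP[aBn _] := aB n.
    by rewrite /postB /post_battery -natrB // natr_nat.
  rewrite /postB /post_battery -natrB // ler_nat.
  by rewrite (leq_trans (leq_subr _ _)) // -ltnS.
by exists Qt, Bt.
Qed.

Lemma sum_natr_indicator (K : nat) (x : 'I_N -> R) (k0 : {ffun 'I_N -> 'I_K.+1})
    (F : {ffun 'I_N -> 'I_K.+1} -> R) :
  (forall n, (k0 n)%:R = x n) ->
  \sum_(k : {ffun 'I_N -> 'I_K.+1}) [forall n, (k n)%:R == x n]%:R * F k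
  = F k0.
Proof.
move=> k0x; rewrite (bigD1 k0) //= big1 ?addr0 => [|k kk0].
  by case: forallP => [_|[]]; [rewrite mul1r | move=> n; rewrite k0x].
case: forallP => [kx|_]; last by rewrite mul0r.
move/negP: kk0 => []; apply/eqP/ffunP => n; apply/val_inj/eqP.
by rewrite -(eqr_nat R) k0x; apply: kx.
Qed.

(** With CSI and action fixed, the right-hand kernels are point masses at a single state [(Qt, Bt)].
    There [post_value] unfolds to the sum on the left. *)
Lemma step_via_post V (H : csi M) Q B a : feasible (actions M) B a ->
  \sum_Q' \sum_B' trQ H Q B a Q' * trB M B a B' * V Q' B'
  = \sum_Qt' \sum_Bt' trQt H Q a Qt' * trBt B a Bt' * post_value M V Qt' Bt'.
Proof.
move=> feas; have [Qt [Bt [QtE BtE]]] := post_state H Q feas.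
under [RHS]eq_bigr => Qt' _ do
  (under eq_bigr => Bt' _ do rewrite -mulrA;
   rewrite -mulr_sumr (sum_natr_indicator _ BtE)).
rewrite (sum_natr_indicator (fun Qt' => post_value M V Qt' Bt) QtE).
by rewrite /post_value /Epre /trQ /trB -(funext QtE) -(funext BtE).
Qed.

(** Moves the CSI average outermost, so that [step_via_post] applies for each CSI realization
    separately. *)
Lemma sum_EcsiM (h : csi M -> queue N Qmax -> battery N Bmax -> R) f :
  \sum_Q \sum_B Ecsi (fun H => h H Q B) * f Q B
  = Ecsi (fun H => \sum_Q \sum_B h H Q B * f Q B).
Proof.
rewrite /Ecsi; under [RHS]eq_bigr => H _ do rewrite mulr_sumr.
rewrite [RHS]exchange_big /=; apply: eq_bigr => Q _.
under [RHS]eq_bigr => H _ do rewrite mulr_sumr.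
rewrite [RHS]exchange_big /=; apply: eq_bigr => B _.
by rewrite mulr_suml; apply: eq_bigr => H _; rewrite mulrA.
Qed.

Lemma reduced_objectiveE eta V Q B (u : collection M) :
  admissible_collection B u ->
  reduced_objective eta V Q B u = post_objective eta (post_value M V) Q B u.
Proof.
move=> /forallP adm; rewrite /reduced_objective /post_objective; congr (_ + _).
rewrite (sum_EcsiM (fun H Q' B' => trQ H Q B (u H) Q' * trB M B (u H) B')).
rewrite (sum_EcsiM (fun H Qt' Bt' => trQt H Q (u H) Qt' * trBt B (u H) Bt')).
by apply: eq_bigr => H _; rewrite step_via_post.
Qed.

Lemma idle_admissible B :
  admissible_collection (M := M) B [ffun=> idle].
Proof.
apply/forallP => H; rewrite ffunE /feasible idle_action /=.
apply/andP; split; first by rewrite big1 // => n _; rewrite ffunE.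
by apply/forallP => n; rewrite !ffunE.
Qed.

Lemma min_objectiveE eta V Q B :
  min_collection (M := M) B (reduced_objective eta V Q B)
  = min_collection (M := M) B (post_objective eta (post_value M V) Q B).
Proof.
(* The default value of the iterated minimum must be converted too; this works because the idle
   collection is admissible. *)
rewrite /min_collection (reduced_objectiveE _ _ _ (idle_admissible B)).
by apply: eq_bigr => u; apply: reduced_objectiveE.
Qed.

Lemma attainsE eta V (Om : policy M) :
  attains (reduced_objective eta V) Om
  <-> attains (post_objective eta (post_value M V)) Om.
Proof.
(* The objectives are known to agree only on admissible collections, so admissibility of [Om] comes
   first. *)
have E : admissible Om -> forall Q B,
    reduced_objective eta V Q B (at_reduced Om Q B)
    = post_objective eta (post_value M V) Q B (at_reduced Om Q B).
  move=> adm Q B; apply: reduced_objectiveE.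
  by apply/forallP => H; rewrite ffunE.
by split=> -[adm opt]; split=> // Q B; move: (opt Q B);
  rewrite E // min_objectiveE.
Qed.

Lemma post_bellman_value eta theta V :
  reduced_bellman M eta theta V -> post_bellman M eta theta (post_value M V).
Proof.
move=> bell Qt Bt; rewrite /post_value -EpreDl.
by apply: eq_Epre => Q B; rewrite bell min_objectiveE.
Qed.

Lemma post_bellman_lift eta theta Vt : post_bellman M eta theta Vt ->
  exists2 V, reduced_bellman M eta theta V & post_value M V =2 Vt.
Proof.
move=> bell.
(* This is the reduced equation solved for [V], with [Vt] standing for the average of [V]; [VE] then
   justifies that substitution. *)
pose V Q B := - theta + min_collection (M := M) B (post_objective eta Vt Q B).
have VE : post_value M V =2 Vt.
  by move=> Qt Bt; rewrite /post_value EpreDl -bell addKr.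
exists V => // Q B; rewrite min_objectiveE addNKr.
by have -> : post_value M V = Vt by apply: funext => Qt; apply: funext => Bt.
Qed.

End PostDecision.

Theorem lemma2 (R : realType) (d : measure_display) (T : measurableType d)
    (P : probability T R) (N Qmax Bmax : nat) (M : system P N Qmax Bmax)
    (eta : 'I_N -> R) (eta_ge0 : forall n, 0 <= eta n) :
  (forall Om : policy M, reduced_policy eta Om <-> post_policy eta Om)
  /\ (forall theta V, reduced_bellman M eta theta V ->
        post_bellman M eta theta (post_value M V)
        /\ forall Om : policy M,
             attains (reduced_objective eta V) Om
             <-> attains (post_objective eta (post_value M V)) Om)
  /\ (forall theta Vt, post_bellman M eta theta Vt ->
        exists2 V, reduced_bellman M eta theta V & post_value M V =2 Vt).
Proof.
split=> [Om|]; last split.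
- split=> [[theta [V [bell att]]]|[theta [Vt [bell att]]]].
    exists theta, (post_value M V).
    by split; [apply: post_bellman_value | apply/attainsE].
  have [V Vbell VE] := post_bellman_lift bell.
  exists theta, V; split=> //; apply/attainsE.
  by have -> : post_value M V = Vt by apply: funext => Qt; apply: funext => Bt.
- move=> theta V bell; split; first exact: post_bellman_value.
  by move=> Om; apply: attainsE.
- by move=> theta Vt; apply: post_bellman_lift.
Qed.
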